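(* Let $M$ be an almost hyperhermitian manifold with metric $\langle\cdot,\cdot\rangle$, almost complex structures $I,J,K$ and Kähler forms $\omega_I,\omega_J,\omega_K$. Let $\nabla$ be the Levi-Civita connection and $\Omega=\sum_{A=I,J,K}\omega_A\wedge\omega_A$. Then the covariant derivatives $\nabla\omega_I$, $\nabla\omega_J$, $\nabla\omega_K$, and the covariant derivative $\nabla\Omega=2\sum_{A=I,J,K}\omega_A\wedge\nabla\omega_A$, are determined by the exterior derivatives $d\omega_I$, $d\omega_J$ and $d\omega_K$.
   Context: A $4n$-dimensional manifold $M$ ($n\ge 1$) is almost hyperhermitian if it is equipped with a Riemannian metric $\langle\cdot,\cdot\rangle$ and three almost complex structures $I,J,K$ satisfying $I^2=J^2=-1$, $K=IJ=-JI$ and $\langle AX,AY\rangle=\langle X,Y\rangle$ for all tangent vectors $X,Y$ at the same point and $A=I,J,K$ (equivalently, an $Sp(n)$-structure). The Kähler forms are $\omega_A(X,Y)=\langle X,AY\rangle$, $A=I,J,K$. ''Determined'' means that, at each point, the values of the covariant derivatives can be computed from the values of $d\omega_I,d\omega_J,d\omega_K$ at that point, together with the algebraic structure $(\langle\cdot,\cdot\rangle,I,J,K)$ at that point. *)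

(* Defs.v *)
From HB Require Import structures.
From mathcomp Require Import all_boot all_order all_algebra.
From mathcomp Require Import all_classical all_reals all_analysis.

Set Implicit Arguments.
Unset Strict Implicit.
Unset Printing Implicit Defensive.

Import Order.TTheory GRing.Theory Num.Theory.
Import numFieldNormedType.Exports.

Local Open Scope classical_set_scope.
Local Open Scope ring_scope.

Section Calculus.
Variables (R : realType) (m : nat).
Implicit Types (f : 'rV[R]_m -> R) (U : set 'rV[R]_m).

Definition partial (i : 'I_m) f : 'rV[R]_m -> R :=
  fun x => 'D_(delta_mx 0 i) (f : 'rV[R]_m -> R^o) x.

(* All iterated partial derivatives are differentiable on U; for open U this
   is equivalent to f being C^oo on U. *)
Definition smooth_on U f : Prop :=
  forall (s : seq 'I_m) (x : 'rV[R]_m), U x ->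
    differentiable (foldr partial f s : 'rV[R]_m -> R^o) x.

(* Covariant tensors of rank 3, 4, 5 on R^m, as arrays of components; those
   of rank 2, and the endomorphisms, are matrices. *)
Definition cov3 := 'I_m -> 'I_m -> 'I_m -> R.
Definition cov4 := 'I_m -> 'I_m -> 'I_m -> 'I_m -> R.
Definition cov5 := 'I_m -> 'I_m -> 'I_m -> 'I_m -> 'I_m -> R.

(* Exterior product of two 2-forms: the sum over (2,2)-shuffles. *)
Definition wedge22 (a b : 'M[R]_m) : cov4 := fun i j k l =>
  a i j * b k l - a i k * b j l + a i l * b j k
  + a j k * b i l - a j l * b i k + a k l * b i j.

(* Components in the frame whose j-th vector is the j-th column of P. *)
Definition frame2 (P : 'M[R]_m) (T : 'M[R]_m) : 'M[R]_m := P^T *m T *m P.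

Definition frame_end (P : 'M[R]_m) (A : 'M[R]_m) : 'M[R]_m :=
  invmx P *m A *m P.

Definition frame3 (P : 'M[R]_m) (T : cov3) : cov3 := fun i j k =>
  \sum_a \sum_b \sum_c P a i * P b j * P c k * T a b c.

Definition frame5 (P : 'M[R]_m) (T : cov5) : cov5 := fun i j k l n =>
  \sum_a \sum_b \sum_c \sum_d \sum_e
    P a i * P b j * P c k * P d l * P e n * T a b c d e.

End Calculus.

(* Smooth manifolds of dimension m; the inverse of a chart is only meaningful
   on the image of its domain. *)
Record manifold (R : realType) (m : nat) := Manifold {
  carrier :> topologicalType;
  manifold_hausdorff : hausdorff_space carrier;
  manifold_second_countable : @second_countable carrier;
  chart : Type;
  chart_dom : chart -> set carrier;
  chart_map : chart -> carrier -> 'rV[R]_m;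
  chart_inv : chart -> 'rV[R]_m -> carrier;
  chart_dom_open : forall c, open (chart_dom c);
  chart_dom_cover : forall p, exists c, chart_dom c p;
  chart_img_open : forall c, open (chart_map c @` chart_dom c);
  chart_mapK : forall c p, chart_dom c p -> chart_inv c (chart_map c p) = p;
  chart_map_continuous :
    forall c, {within chart_dom c, continuous (chart_map c)};
  chart_inv_continuous :
    forall c, {within chart_map c @` chart_dom c, continuous (chart_inv c)};
  transition_smooth : forall c c' (i : 'I_m),
    smooth_on (chart_map c @` (chart_dom c `&` chart_dom c'))
      (fun x => chart_map c' (chart_inv c x) 0 i)
}.

Definition img (R : realType) (m : nat) (M : manifold R m) (c : chart M) :=
  chart_map c @` chart_dom c.

Definition overlap (R : realType) (m : nat) (M : manifold R m)
  (c c' : chart M) := chart_map c @` (chart_dom c `&` chart_dom c').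

Section Tensors.
Variables (R : realType) (m : nat) (M : manifold R m).
Implicit Types (c : chart M) (x : 'rV[R]_m).

Definition transition c c' : 'rV[R]_m -> 'rV[R]_m :=
  fun x => chart_map c' (chart_inv c x).

(* 'J acts on row vectors, so its entry (j, i) is the derivative of the i-th
   component along the j-th variable. The transpose is the usual Jacobian,
   acting on column vectors. *)
Definition jac c c' x : 'M[R]_m := ('J (transition c c') x)^T.

(* Tensor fields are given by their components in each chart, at the point
   with coordinates x; values off the image of the chart are irrelevant.
   A tensor of type (0,2) has T i j = T(d_i, d_j). *)
Record field2 := Field2 {
  field2_val :> chart M -> 'rV[R]_m -> 'M[R]_m;
  field2_smooth : forall c i j,
    smooth_on (img c) (fun x => field2_val c x i j);
  field2_change : forall c c' x, overlap c c' x ->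
    field2_val c x =
    (jac c c' x)^T *m field2_val c' (transition c c' x) *m jac c c' x
}.

(* Endomorphisms of the tangent bundle act on column vectors, i.e.
   A d_j = \sum_i A i j d_i, so that composition is *m. *)
Record field_end := FieldEnd {
  field_end_val :> chart M -> 'rV[R]_m -> 'M[R]_m;
  field_end_smooth : forall c i j,
    smooth_on (img c) (fun x => field_end_val c x i j);
  field_end_change : forall c c' x, overlap c c' x ->
    jac c c' x *m field_end_val c x =
    field_end_val c' (transition c c' x) *m jac c c' x
}.

(* Affine connections, by their Christoffel symbols
   nabla_(d_i) d_j = \sum_k (Gamma k i j) d_k. *)
Record connection := Connection {
  christoffel :> chart M -> 'rV[R]_m -> 'I_m -> 'I_m -> 'I_m -> R;
  christoffel_smooth : forall c k i j,
    smooth_on (img c) (fun x => christoffel c x k i j);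
  christoffel_change : forall c c' x, overlap c c' x ->
    forall a i j,
    \sum_k jac c c' x a k * christoffel c x k i j =
    partial i (partial j (fun y => transition c c' y 0 a)) x
    + \sum_b \sum_d christoffel c' (transition c c' x) a b d
                    * jac c c' x b i * jac c c' x d j
}.

(* The differential operators below act on the components in one chart. The
   first index of a covariant derivative is the direction of derivation. *)
Definition ext_d (w : chart M -> 'rV[R]_m -> 'M[R]_m) c x : cov3 R m :=
  fun i j k =>
    partial i (fun y => w c y j k) x
    + partial j (fun y => w c y k i) x
    + partial k (fun y => w c y i j) x.

Definition nabla2 (D : connection) (w : chart M -> 'rV[R]_m -> 'M[R]_m) c x
    : cov3 R m := fun a i j =>
  partial a (fun y => w c y i j) x
  - \sum_b D c x b a i * w c x b j
  - \sum_b D c x b a j * w c x i b.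

Definition nabla4 (D : connection) (W : chart M -> 'rV[R]_m -> cov4 R m) c x
    : cov5 R m := fun a i j k l =>
  partial a (fun y => W c y i j k l) x
  - \sum_b D c x b a i * W c x b j k l
  - \sum_b D c x b a j * W c x i b k l
  - \sum_b D c x b a k * W c x i j b l
  - \sum_b D c x b a l * W c x i j k b.

Definition levi_civita (g : field2) (D : connection) : Prop :=
  (forall c x k i j, img c x -> D c x k i j = D c x k j i) /\
  (forall c x a i j, img c x -> nabla2 D g c x a i j = 0).

End Tensors.

Variant hyper := hI | hJ | hK.

Record almost_hyperhermitian (R : realType) (n : nat)
    (M : manifold R (4 * n)) := AlmostHyperhermitian {
  metric : field2 M;
  acs : hyper -> field_end M;
  metric_sym : forall c x, img c x ->
    (metric c x)^T = metric c x;
  metric_pos : forall c x (v : 'cV[R]_(4 * n)), img c x ->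
    v != 0 -> 0 < (v^T *m metric c x *m v) 0 0;
  acs_sqr : forall A c x, img c x ->
    acs A c x *m acs A c x = - 1%:M;
  acs_K : forall c x, img c x ->
    acs hK c x = acs hI c x *m acs hJ c x;
  acs_KN : forall c x, img c x ->
    acs hK c x = - (acs hJ c x *m acs hI c x);
  acs_hermitian : forall A c x, img c x ->
    (acs A c x)^T *m metric c x *m acs A c x = metric c x
}.

Section KahlerForms.
Variables (R : realType) (n : nat) (M : manifold R (4 * n)).
Variable (H : almost_hyperhermitian M).

(* omega_A(X, Y) = <X, A Y>. *)
Definition omega (A : hyper) : chart M -> 'rV[R]_(4 * n) -> 'M[R]_(4 * n) :=
  fun c x => metric H c x *m acs H A c x.

Definition Omega : chart M -> 'rV[R]_(4 * n) -> cov4 R (4 * n) :=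
  fun c x i j k l =>
    \sum_(A <- [:: hI; hJ; hK]) wedge22 (omega A c x) (omega A c x) i j k l.

(* The value at a point, in the frame P, of the algebraic structure and of
   the exterior derivatives of the Kahler forms. *)
Definition metric_at c x P := frame2 P (metric H c x).
Definition acs_at c x P (A : hyper) := frame_end P (acs H A c x).
Definition d_omega_at c x P (A : hyper) := frame3 P (ext_d (omega A) c x).

End KahlerForms.

(* Main.v *)
Require Import Defs.
From HB Require Import structures.
From mathcomp Require Import all_boot all_order all_algebra.
From mathcomp Require Import all_classical all_reals all_analysis.
From mathcomp Require Import ring lra.

Set Implicit Arguments.
Unset Strict Implicit.
Unset Printing Implicit Defensive.

Import Order.TTheory GRing.Theory Num.Theory.
Import numFieldNormedType.Exports.

Local Open Scope classical_set_scope.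
Local Open Scope ring_scope.

(** Write alpha_A(X; Y, Z) for the covariant derivative of omega_A in the
    direction X, evaluated on Y and Z. It is skew in (Y, Z), and since the
    connection is torsion-free, d omega_A is the cyclic sum of alpha_A. Two more
    relations come from differentiating algebraic identities between I, J, K and
    a parallel metric. From A^2 = -1,
      alpha_A(X; A Y, Z) = alpha_A(X; Y, A Z);
    and for a cyclic permutation (A, B, C) of (I, J, K), where C = - B A,
      alpha_A(X; B Y, Z) = alpha_C(X; Y, Z) + alpha_B(X; Y, A Z).
    For (A, B, C) = (I, J, K) the second relation turns the combination
      d omega_K(J X, Y, Z) + d omega_J(J X, Y, I Z)
        - d omega_K(J X, I Y, I Z) + d omega_J(J X, I Y, Z)
    into an expression in alpha_I alone, of the kind found in the Nijenhuis tensor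
    of I. In it the derivatives along J X cancel, and what remains is the opposite
    of what the derivatives along Y, Z, I Y and I Z contribute to
      d omega_I(X, Y, Z) - d omega_I(X, I Y, I Z).
    The derivatives along X contribute 2 alpha_I(X; Y, Z) to the latter, by the
    first relation, so this is the sum of the two combinations. This is
    [cyclic_sum_inversion], and [nabla_omega_inversion] on the manifold. The
    formula is multilinear and built from the endomorphisms and the exterior
    derivatives only, so it holds in every frame ([inversion_frame]).

    The statement on Omega is the Leibniz rule for the exterior square of a form
    ([nabla4_wedge22]), whose components transform factor by factor
    ([frame5_wedge22]). *)

(** * Trilinear evaluation of components *)

Section Evaluation.
Variables (R : realType) (m : nat).
Implicit Types (T : cov3 R m) (U V W : 'cV[R]_m) (P Q : 'M[R]_m).

Definition slice T (a : 'I_m) : 'M[R]_m := \matrix_(i, j) T a i j.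

(** T(U, V, W), written with matrices so that matrix identities between the
    slices of several tensors carry over to all vectors at once. *)
Definition tri T U V W : R := (V^T *m (\sum_a U a 0 *: slice T a) *m W) 0 0.

Definition cyclic_sum T : cov3 R m := fun i j k => T i j k + T j k i + T k i j.

Lemma eq_cov3 T T' : (forall i j k, T i j k = T' i j k) -> T = T'.
Proof.
by move=> TT'; apply: funext => i; apply: funext => j; apply: funext => k.
Qed.

Lemma triE T U V W :
  tri T U V W = \sum_a \sum_b \sum_c U a 0 * V b 0 * W c 0 * T a b c.
Proof.
rewrite /tri mulmx_sumr mulmx_suml summxE; apply: eq_bigr => a _.
rewrite -scalemxAr -scalemxAl mxE -mulmxA mxE mulr_sumr.
apply: eq_bigr => b _; rewrite !mxE !mulr_sumr; apply: eq_bigr => c _.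
by rewrite mxE; ring.
Qed.

Lemma tri_rot T U V W : tri (fun i j k => T j k i) U V W = tri T V W U.
Proof.
rewrite !triE exchange_big; apply: eq_bigr => b _.
rewrite exchange_big; apply: eq_bigr => c _; apply: eq_bigr => a _.
by ring.
Qed.

Lemma tri_cyclic T U V W :
  tri (cyclic_sum T) U V W = tri T U V W + tri T V W U + tri T W U V.
Proof.
rewrite -(tri_rot T V) -(tri_rot T U) -(tri_rot (fun i j k => T j k i) U) !triE.
rewrite -!big_split; apply: eq_bigr => a _; rewrite -!big_split.
apply: eq_bigr => b _; rewrite -!big_split; apply: eq_bigr => c _ /=.
by rewrite /cyclic_sum; ring.
Qed.

Lemma triNr T U V W : tri T U V (- W) = - tri T U V W.
Proof. by rewrite /tri mulmxN mxE. Qed.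

Lemma triNm T U V W : tri T U (- V) W = - tri T U V W.
Proof. by rewrite /tri linearN mulNmx mulNmx mxE. Qed.

Lemma frame3_tri P T i j k :
  frame3 P T i j k = tri T (col i P) (col j P) (col k P).
Proof.
rewrite triE /frame3; apply: eq_bigr => a _; apply: eq_bigr => b _.
by apply: eq_bigr => c _; rewrite !mxE.
Qed.
Lemma tri_frame3 P T U V W :
  tri (frame3 P T) U V W = tri T (P *m U) (P *m V) (P *m W).
Proof.
suff Hs a : slice (frame3 P T) a = P^T *m (\sum_b P b a *: slice T b) *m P.
  rewrite /tri trmx_mul !mulmxA; congr ((_ *m _) _ _).
  under eq_bigr do rewrite Hs scalemxAl scalemxAr.
  rewrite -mulmx_suml mulmxA -mulmx_sumr -!mulmxA; do 3 congr (_ *m _).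
  under eq_bigr do rewrite scaler_sumr.
  rewrite exchange_big; apply: eq_bigr => b _.
  rewrite mxE scaler_suml; apply: eq_bigr => i _.
  by rewrite scalerA mulrC.
apply/matrixP=> i j; rewrite mxE frame3_tri /tri.
under [in LHS]eq_bigr do rewrite mxE.
by rewrite !mxE; apply: eq_bigr => k _; rewrite !mxE; congr (_ * _);
   apply: eq_bigr => l _; rewrite !mxE.
Qed.
End Evaluation.

(** * Inverting the exterior derivatives *)

Section Inversion.
Variables (R : realType) (m : nat).
Implicit Types (T d : cov3 R m) (A B P : 'M[R]_m) (U V W : 'cV[R]_m).

(** With T_A, T_B, T_C the covariant derivatives of the three Kahler forms and
    dA, dB, dC their exterior derivatives, this is T_A (U, V, W) expressed
    through dA, dB, dC. *)
Definition inversion A B dA dB dC U V W : R :=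
  (tri dA U V W - tri dA U (A *m V) (A *m W)
   + tri dC (B *m U) V W + tri dB (B *m U) V (A *m W)
   - tri dC (B *m U) (A *m V) (A *m W) + tri dB (B *m U) (A *m V) W) / 2.

(** The relation with B rewrites the four terms in dB and dC as values of TA: the
    pairs of terms whose first argument is V, A V, W or A W are the contributions
    to - dA(U, V, W) + dA(U, A V, A W) of the same directions, and the terms whose
    first argument is B U cancel. What is left of dA is 2 TA (U, V, W). *)
Lemma cyclic_sum_inversion A B TA TB TC :
    A *m A = - 1%:M -> B *m B = - 1%:M -> B *m A = - (A *m B) ->
    (forall U V W, tri TA U V W = - tri TA U W V) ->
    (forall U V W, tri TB U V W = - tri TB U W V) ->
    (forall U V W, tri TC U V W = - tri TC U W V) ->
    (forall U V W, tri TA U (A *m V) W = tri TA U V (A *m W)) ->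
    (forall U V W,
      tri TA U (B *m V) W = tri TC U V W + tri TB U V (A *m W)) ->
  forall U V W, tri TA U V W =
    inversion A B (cyclic_sum TA) (cyclic_sum TB) (cyclic_sum TC) U V W.
Proof.
move=> AA BB BA skA skB skC HA HB U V W; rewrite /inversion !tri_cyclic.
have AK X : A *m (A *m X) = - X by rewrite mulmxA AA mulNmx mul1mx.
have BK X : B *m (B *m X) = - X by rewrite mulmxA BB mulNmx mul1mx.
have A2 X Y Z : tri TA X (A *m Y) (A *m Z) = - tri TA X Y Z.
  by rewrite HA AK triNr.
have HBA X Y Z :
    tri TA X (B *m Y) (A *m Z) = tri TC X Y (A *m Z) - tri TB X Y Z.
  by rewrite HB AK triNr.
have HBU Y Z : - tri TA Y U Z = tri TC Y (B *m U) Z + tri TB Y (B *m U) (A *m Z).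
  by rewrite -HB BK triNm.
have HBAU Y Z :
    - tri TA Y U (A *m Z) = tri TC Y (B *m U) (A *m Z) - tri TB Y (B *m U) Z.
  by rewrite -HBA BK triNm.
(* The terms with first argument B U cancel because A anticommutes with B,
   so that B A V and A W pair as B V and W do. *)
have U1 := HB (B *m U) V W.
have U2 : tri TA (B *m U) (B *m V) W
    = tri TC (B *m U) (A *m V) (A *m W) - tri TB (B *m U) (A *m V) W.
  by rewrite -HBA mulmxA BA mulNmx -mulmxA triNm A2 opprK.
have V1 := HBU V W; have V2 := HBAU (A *m V) W.
have W1 := HBU W V; have W2 := HBAU (A *m W) V.
rewrite (skC V W) (skB V (A *m W)) (skC (A *m V) (A *m W)) (skB (A *m V) W).
rewrite (skA V W) (skA (A *m V) (A *m W)) A2; lra.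
Qed.

Lemma inversion_frame P A B dA dB dC U V W : P \in unitmx ->
  inversion (frame_end P A) (frame_end P B)
    (frame3 P dA) (frame3 P dB) (frame3 P dC) U V W =
  inversion A B dA dB dC (P *m U) (P *m V) (P *m W).
Proof.
move=> Pu; rewrite /inversion !tri_frame3.
have PK Q X : P *m (frame_end P Q *m X) = Q *m (P *m X).
  by rewrite /frame_end !mulmxA mulmxV // mul1mx.
by rewrite !PK.
Qed.

End Inversion.

(** * Frame components of products *)

Section Frame5.
Variables (R : realType) (m : nat).
Implicit Types (T : cov3 R m) (u P : 'M[R]_m) (p q r s t : 'I_m -> R).

(** With one weight per slot, so that a permutation of the slots of X is a
    permutation of the weights. *)
Definition sum5 p q r s t (X : cov5 R m) : R :=
  \sum_a \sum_b \sum_c \sum_d \sum_e p a * q b * r c * s d * t e * X a b c d e.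

Lemma sum5_swap23 p q r s t X :
  sum5 p q r s t X = sum5 p r q s t (fun a c b => X a b c).
Proof.
apply: eq_bigr => a _; rewrite exchange_big; apply: eq_bigr => c _.
apply: eq_bigr => b _; apply: eq_bigr => d _; apply: eq_bigr => e _ /=.
by ring.
Qed.

Lemma sum5_swap34 p q r s t X :
  sum5 p q r s t X = sum5 p q s r t (fun a b d c => X a b c d).
Proof.
apply: eq_bigr => a _; apply: eq_bigr => b _; rewrite exchange_big.
apply: eq_bigr => d _; apply: eq_bigr => c _; apply: eq_bigr => e _ /=.
by ring.
Qed.

Lemma sum5_swap45 p q r s t X :
  sum5 p q r s t X = sum5 p q r t s (fun a b c e d => X a b c d e).
Proof.
apply: eq_bigr => a _; apply: eq_bigr => b _; apply: eq_bigr => c _.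
rewrite exchange_big; apply: eq_bigr => e _; apply: eq_bigr => d _ /=.
by ring.
Qed.

Lemma sum5_mul P u T a i j k l :
  sum5 (P^~ a) (P^~ i) (P^~ j) (P^~ k) (P^~ l)
    (fun a' i' j' k' l' => u i' j' * T a' k' l')
  = frame2 P u i j * frame3 P T a k l.
Proof.
rewrite /sum5 /frame3 mulr_sumr; apply: eq_bigr => a' _.
have -> : frame2 P u i j = \sum_b \sum_c P b i * P c j * u b c.
  rewrite exchange_big /frame2 mxE; apply: eq_bigr => c _.
  rewrite mxE mulr_suml; apply: eq_bigr => b _; rewrite mxE.
  by ring.
rewrite mulr_suml; apply: eq_bigr => b _.
rewrite mulr_suml; apply: eq_bigr => c _.
rewrite mulr_sumr; apply: eq_bigr => d _.
rewrite mulr_sumr; apply: eq_bigr => e _.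
by ring.
Qed.

(** Each of the six terms of the exterior product is a product of components
    whose slots have to be brought into the order of [sum5_mul]. *)
Lemma frame5_wedge22 P u T a i j k l :
  frame5 P (fun a' i' j' k' l' => wedge22 u (slice T a') i' j' k' l') a i j k l
  = wedge22 (frame2 P u) (slice (frame3 P T) a) i j k l.
Proof.
pose S5 := sum5 (P^~ a) (P^~ i) (P^~ j) (P^~ k) (P^~ l).
transitivity (S5 (fun a i j k l => u i j * T a k l)
  - S5 (fun a i j k l => u i k * T a j l)
  + S5 (fun a i j k l => u i l * T a j k)
  + S5 (fun a i j k l => u j k * T a i l)
  - S5 (fun a i j k l => u j l * T a i k)
  + S5 (fun a i j k l => u k l * T a i j)).
  rewrite -!sumrN -!big_split; apply: eq_bigr => a' _.
  rewrite -!sumrN -!big_split; apply: eq_bigr => i' _.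
  rewrite -!sumrN -!big_split; apply: eq_bigr => j' _.
  rewrite -!sumrN -!big_split; apply: eq_bigr => k' _.
  rewrite -!sumrN -!big_split; apply: eq_bigr => l' _ /=.
  by rewrite /wedge22 !mxE; ring.
rewrite /wedge22 ![slice _ _ _ _]mxE -!sum5_mul /S5.
congr (_ - _ + _ + _ - _ + _).
- by rewrite sum5_swap34.
- by rewrite sum5_swap45 sum5_swap34.
- by rewrite sum5_swap23 sum5_swap34.
- by rewrite sum5_swap23 sum5_swap45 sum5_swap34.
- by rewrite sum5_swap34 sum5_swap23 sum5_swap45 sum5_swap34.
Qed.

End Frame5.

(** * Partial derivatives of matrix-valued functions *)

Section MatrixDerivative.
Variables (R : realType) (m : nat).
Implicit Types (f g : 'rV[R]_m -> R) (F G : 'rV[R]_m -> 'M[R]_m) (x : 'rV[R]_m).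
Implicit Types (a : 'I_m).

Definition has_partials f x :=
  forall a, derivable (f : 'rV[R]_m -> R^o) x (delta_mx 0 a).

Definition has_partialsmx F x := forall i j, has_partials (fun y => F y i j) x.

Definition partialmx a F x : 'M[R]_m :=
  \matrix_(i, j) partial a (fun y => F y i j) x.

Lemma smooth_has_partials U f x : smooth_on U f -> U x -> has_partials f x.
Proof. by move=> sf Ux a; apply: diff_derivable; exact: (sf [::]). Qed.

Lemma has_partialsM f g x : has_partials f x -> has_partials g x ->
  has_partials (fun y => f y * g y) x.
Proof. by move=> df dg a; apply: (@derivableM R _ f g). Qed.

Lemma partialM a f g x : has_partials f x -> has_partials g x ->
  partial a (fun y => f y * g y) x = partial a f x * g x + f x * partial a g x.
Proof.
move=> df dg; rewrite /partial (@deriveM R _ f g) //.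
by rewrite addrC; congr (_ + _); rewrite /GRing.scale /= mulrC.
Qed.

Lemma has_partialsD f g x : has_partials f x -> has_partials g x ->
  has_partials (fun y => f y + g y) x.
Proof. by move=> df dg a; apply: (@derivableD R _ _ f g). Qed.

Lemma partialD a f g x : has_partials f x -> has_partials g x ->
  partial a (fun y => f y + g y) x = partial a f x + partial a g x.
Proof. by move=> df dg; rewrite /partial (@deriveD R _ _ f g). Qed.

Lemma has_partialsN f x : has_partials f x -> has_partials (fun y => - f y) x.
Proof. by move=> df a; apply: (@derivableN R _ _ f). Qed.

Lemma partialN a f x : has_partials f x ->
  partial a (fun y => - f y) x = - partial a f x.
Proof. by move=> df; rewrite /partial (@deriveN R _ _ f). Qed.

Lemma sum_fctE (n : nat) (h : 'I_n -> 'rV[R]_m -> R) :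
  (fun y => \sum_i h i y) = \sum_i h i.
Proof. by apply/funext => y; rewrite fct_sumE. Qed.

Lemma has_partials_sum (n : nat) (h : 'I_n -> 'rV[R]_m -> R) x :
  (forall i, has_partials (h i) x) -> has_partials (fun y => \sum_i h i y) x.
Proof.
by move=> dh a; rewrite sum_fctE; apply: (@derivable_sum R _ _ n h) => i; apply: dh.
Qed.

Lemma partial_sum (n : nat) (h : 'I_n -> 'rV[R]_m -> R) a x :
    (forall i, has_partials (h i) x) ->
  partial a (fun y => \sum_i h i y) x = \sum_i partial a (h i) x.
Proof.
by move=> dh; rewrite /partial sum_fctE (@derive_sum R _ _ n h) // => i; apply: dh.
Qed.

Lemma has_partialsmxM F G x : has_partialsmx F x -> has_partialsmx G x ->
  has_partialsmx (fun y => F y *m G y) x.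
Proof.
move=> dF dG i j; under eq_fun do rewrite mxE.
by apply: has_partials_sum => k; apply: has_partialsM.
Qed.

Lemma partialmxM a F G x : has_partialsmx F x -> has_partialsmx G x ->
  partialmx a (fun y => F y *m G y) x
  = partialmx a F x *m G x + F x *m partialmx a G x.
Proof.
move=> dF dG; apply/matrixP=> i j; rewrite !mxE.
under eq_fun do rewrite mxE.
rewrite partial_sum => [|k]; last exact: has_partialsM.
rewrite -big_split; apply: eq_bigr => k _ /=.
by rewrite partialM // !mxE.
Qed.

Lemma partialmxN a F x : has_partialsmx F x ->
  partialmx a (fun y => - F y) x = - partialmx a F x.
Proof.
move=> dF; apply/matrixP=> i j; rewrite !mxE.
by under eq_fun do rewrite mxE; rewrite partialN.
Qed.

Lemma partialmx_tr a F x : partialmx a (fun y => (F y)^T) x = (partialmx a F x)^T.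
Proof. by apply/matrixP=> i j; rewrite !mxE; under eq_fun do rewrite mxE. Qed.

Lemma partialmx_cst a (C : 'M[R]_m) x : partialmx a (fun=> C) x = 0.
Proof. by apply/matrixP=> i j; rewrite !mxE /partial; exact: derive_cst. Qed.

(** The algebraic identities of an almost hyperhermitian structure hold on the
    image of a chart only, which suffices to differentiate them. *)
Lemma eq_partialmx a F G (U : set 'rV[R]_m) x : open U -> U x ->
  (forall y, U y -> F y = G y) -> partialmx a F x = partialmx a G x.
Proof.
move=> oU Ux FG; apply/matrixP=> i j; rewrite !mxE; apply: near_eq_derive.
by near=> y; rewrite FG //; near: y; exact: open_nbhs_nbhs.
Unshelve. all: by end_near. Qed.

End MatrixDerivative.

(** * Covariant derivatives in a chart *)

Section CovariantDerivative.
Variables (R : realType) (m : nat) (M : manifold R m) (D : connection M).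
Variables (c : chart M) (x : 'rV[R]_m).
Implicit Types (a : 'I_m) (w : chart M -> 'rV[R]_m -> 'M[R]_m).

Definition christoffelmx a : 'M[R]_m := \matrix_(b, j) D c x b a j.

Lemma slice_nabla2 w a :
  slice (nabla2 D w c x) a = partialmx a (w c) x
    - (christoffelmx a)^T *m w c x - w c x *m christoffelmx a.
Proof.
apply/matrixP=> i j; rewrite !mxE /nabla2.
congr (_ - _ - _); apply: eq_bigr => b _; rewrite !mxE //.
by rewrite mulrC.
Qed.

Definition nabla_end w a : 'M[R]_m :=
  partialmx a (w c) x + christoffelmx a *m w c x - w c x *m christoffelmx a.

(** Leibniz rule for the contraction of a parallel form g with A. *)
Lemma slice_nabla2_mul (g A : chart M -> 'rV[R]_m -> 'M[R]_m) a :
    has_partialsmx (g c) x -> has_partialsmx (A c) x ->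
    slice (nabla2 D g c x) a = 0 ->
  slice (nabla2 D (fun c y => g c y *m A c y) c x) a = g c x *m nabla_end A a.
Proof.
move=> dg dA; rewrite !slice_nabla2 partialmxM // /nabla_end.
move/eqP; rewrite subr_eq0 subr_eq => /eqP ->.
rewrite mulmxBr !mulmxDr mulmxDl !mulmxA.
move: (_ *m A c x) (_ *m A c x) (_ *m partialmx _ _ _) (_ *m christoffelmx a).
by move=> X Y Z T; apply/matrixP=> i j; rewrite !mxE; ring.
Qed.

Lemma nabla_endM (A B : chart M -> 'rV[R]_m -> 'M[R]_m) a :
    has_partialsmx (A c) x -> has_partialsmx (B c) x ->
  nabla_end (fun c y => A c y *m B c y) a
  = nabla_end A a *m B c x + A c x *m nabla_end B a.
Proof.
move=> dA dB; rewrite /nabla_end partialmxM //.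
rewrite mulmxBr mulmxBl !mulmxDr !mulmxDl !mulmxA.
move: (_ *m B c x) (_ *m B c x) (_ *m B c x) (_ *m partialmx _ _ _).
move: (_ *m christoffelmx a).
by move=> X Y Z T S; apply/matrixP=> i j; rewrite !mxE; ring.
Qed.

Lemma nabla_endN (A : chart M -> 'rV[R]_m -> 'M[R]_m) a :
    has_partialsmx (A c) x ->
  nabla_end (fun c y => - A c y) a = - nabla_end A a.
Proof.
move=> dA; rewrite /nabla_end partialmxN // mulmxN mulNmx.
by rewrite !opprD !opprK.
Qed.

Lemma nabla_end1 a : nabla_end (fun _ _ => 1%:M) a = 0.
Proof. by rewrite /nabla_end partialmx_cst mulmx1 mul1mx add0r subrr. Qed.

Lemma eq_nabla_end (A B : chart M -> 'rV[R]_m -> 'M[R]_m) a :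
    img c x -> (forall y, img c y -> A c y = B c y) ->
  nabla_end A a = nabla_end B a.
Proof.
move=> cx AB; rewrite /nabla_end AB //.
by rewrite (eq_partialmx a (@chart_img_open _ _ M c) cx AB).
Qed.

Lemma slice_nabla2_skew w a :
    img c x -> has_partialsmx (w c) x ->
    (forall y, img c y -> (w c y)^T = - w c y) ->
  (slice (nabla2 D w c x) a)^T = - slice (nabla2 D w c x) a.
Proof.
move=> cx dw skw; rewrite slice_nabla2 !linearB /= -partialmx_tr.
rewrite (eq_partialmx a (@chart_img_open _ _ M c) cx skw) partialmxN //.
rewrite !trmx_mul trmxK skw // mulNmx mulmxN.
move: (partialmx _ _ _) (_ *m _) (_ *m _) => X Y Z.
by apply/matrixP=> i j; rewrite !mxE; ring.
Qed.

(** The Christoffel terms cancel in pairs, because the connection is symmetric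
    and the form is skew. *)
Lemma ext_d_nabla2 w :
    (forall k i j, D c x k i j = D c x k j i) -> (w c x)^T = - w c x ->
  ext_d w c x = cyclic_sum (nabla2 D w c x).
Proof.
move=> Dsym skw; apply: eq_cov3 => i j k.
have sk b d : w c x b d = - w c x d b.
  by rewrite -[in LHS](trmxK (w c x)) skw !mxE.
have cancel p q r :
    \sum_b D c x b p q * w c x b r = - \sum_b D c x b q p * w c x r b.
  by rewrite -sumrN; apply: eq_bigr => b _; rewrite Dsym sk mulrN.
rewrite /ext_d /cyclic_sum /nabla2 (cancel i j) (cancel j k) (cancel k i).
by ring.
Qed.

(** * The covariant derivative of an exterior square *)

Lemma nabla4D (W1 W2 : chart M -> 'rV[R]_m -> cov4 R m) a i j k l :
    (forall i j k l, has_partials (fun y => W1 c y i j k l) x) ->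
    (forall i j k l, has_partials (fun y => W2 c y i j k l) x) ->
  nabla4 D (fun c y i j k l => W1 c y i j k l + W2 c y i j k l) c x a i j k l
  = nabla4 D W1 c x a i j k l + nabla4 D W2 c x a i j k l.
Proof.
move=> d1 d2; rewrite /nabla4 partialD //.
have sD (d f g : 'I_m -> R) :
    \sum_b d b * (f b + g b) = \sum_b d b * f b + \sum_b d b * g b.
  by rewrite -big_split; apply: eq_bigr => b _; rewrite mulrDr.
by rewrite !sD; ring.
Qed.

Lemma has_partials_wedge22 w i j k l : has_partialsmx (w c) x ->
  has_partials (fun y => wedge22 (w c y) (w c y) i j k l) x.
Proof.
move=> dw.
have dM p q r s : has_partials (fun y => w c y p q * w c y r s) x.
  exact: has_partialsM.
have dN p q r s := has_partialsN (dM p q r s).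
exact: (has_partialsD (has_partialsD (has_partialsD (has_partialsD
  (has_partialsD (dM _ _ _ _) (dN _ _ _ _)) (dM _ _ _ _)) (dM _ _ _ _))
  (dN _ _ _ _)) (dM _ _ _ _)).
Qed.

(** Leibniz rule; the factor 2 appears because the exterior product of 2-forms
    is symmetric. *)
Lemma nabla4_wedge22 w a i j k l : has_partialsmx (w c) x ->
  nabla4 D (fun c y => wedge22 (w c y) (w c y)) c x a i j k l
  = 2 * wedge22 (w c x) (slice (nabla2 D w c x) a) i j k l.
Proof.
move=> dw.
have dM p q r s : has_partials (fun y => w c y p q * w c y r s) x.
  exact: has_partialsM.
(* Substituting one slot of the exterior square: e is the resulting function of
   the summation index, in which each term contains one varying factor. *)
have slot (d e f g h : 'I_m -> R) (p q r : R) :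
    (forall b, e b = 2 * (p * f b + q * g b + r * h b)) ->
    \sum_b d b * e b = 2 * (p * (\sum_b d b * f b) + q * (\sum_b d b * g b)
                            + r * (\sum_b d b * h b)).
  move=> eE; rewrite !mulr_sumr -!big_split mulr_sumr; apply: eq_bigr => b _ /=.
  by rewrite eE; ring.
rewrite /nabla4.
rewrite (slot (fun b => D c x b a i) _ (w c x ^~ j) (w c x ^~ k) (w c x ^~ l)
  (w c x k l) (- w c x j l) (w c x j k)); last by move=> b; rewrite /wedge22; ring.
rewrite (slot (fun b => D c x b a j) _ (w c x i) (w c x ^~ k) (w c x ^~ l)
  (w c x k l) (w c x i l) (- w c x i k)); last by move=> b; rewrite /wedge22; ring.
rewrite (slot (fun b => D c x b a k) _ (w c x i) (w c x j) (w c x ^~ l)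
  (- w c x j l) (w c x i l) (w c x i j)); last by move=> b; rewrite /wedge22; ring.
rewrite (slot (fun b => D c x b a l) _ (w c x i) (w c x j) (w c x k)
  (w c x j k) (- w c x i k) (w c x i j)); last by move=> b; rewrite /wedge22; ring.
have -> : partial a (fun y => wedge22 (w c y) (w c y) i j k l) x
    = 2 * wedge22 (w c x) (partialmx a (w c) x) i j k l.
  rewrite {1}/wedge22.
  have dN p q r s := has_partialsN (dM p q r s).
  have d2 := has_partialsD (dM i j k l) (dN i k j l).
  have d3 := has_partialsD d2 (dM i l j k).
  have d4 := has_partialsD d3 (dM j k i l).
  have d5 := has_partialsD d4 (dN j l i k).
  rewrite (partialD a d5 (dM _ _ _ _)) (partialD a d4 (dN _ _ _ _)).
  rewrite (partialD a d3 (dM _ _ _ _)) (partialD a d2 (dM _ _ _ _)).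
  rewrite (partialD a (dM _ _ _ _) (dN _ _ _ _)) !(partialN a (dM _ _ _ _)).
  by rewrite !(partialM a (dw _ _) (dw _ _)) /wedge22 !mxE; ring.
rewrite /wedge22 !mxE /nabla2; ring.
Qed.

End CovariantDerivative.

(** * Almost hyperhermitian manifolds *)

Definition cyc (A : hyper) : hyper :=
  match A with hI => hJ | hJ => hK | hK => hI end.

Section Hyperhermitian.
Variables (R : realType) (n : nat) (M : manifold R (4 * n)).
Variables (H : almost_hyperhermitian M) (D : connection M).
Hypothesis hD : levi_civita (metric H) D.
Variables (c : chart M) (x : 'rV[R]_(4 * n)).
Hypothesis cx : img c x.
Implicit Types (A : hyper).

(** The relation K = - J I survives cyclic permutations of (I, J, K), so the three
    forms can be treated alike. *)
Lemma acs_cyc A y : img c y ->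
  acs H (cyc (cyc A)) c y = - (acs H (cyc A) c y *m acs H A c y).
Proof.
move=> cy; case: A => /=; first exact: acs_KN.
  by rewrite acs_K // -mulmxA acs_sqr // mulmxN mulmx1 opprK.
by rewrite acs_K // mulmxA acs_sqr // mulNmx mul1mx opprK.
Qed.

Lemma acs_anticommute A :
  acs H (cyc A) c x *m acs H A c x = - (acs H A c x *m acs H (cyc A) c x).
Proof.
case: A => /=.
- by rewrite -acs_K // acs_KN // opprK.
- rewrite [in LHS]acs_K // acs_KN // -mulmxA acs_sqr // mulmxN mulmx1.
  by rewrite mulmxN mulmxA acs_sqr // mulNmx mul1mx opprK.
- rewrite [in LHS]acs_K // acs_KN // mulmxA acs_sqr // mulNmx mul1mx.
  by rewrite mulNmx -mulmxA acs_sqr // mulmxN mulmx1 opprK.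
Qed.

(** Compatibility with the metric and A^2 = -1 together say that A is skew, which
    is why omega_A is a form. *)
Lemma acs_skew A y : img c y ->
  (acs H A c y)^T *m metric H c y = - (metric H c y *m acs H A c y).
Proof.
move=> cy; rewrite -[in RHS](acs_hermitian H A cy) -mulmxA acs_sqr //.
by rewrite mulmxN mulmx1 opprK.
Qed.

Lemma omega_skew A y : img c y -> (omega H A c y)^T = - omega H A c y.
Proof. by move=> cy; rewrite /omega trmx_mul Defs.metric_sym // acs_skew. Qed.

Lemma metric_has_partials : has_partialsmx (metric H c) x.
Proof. by move=> i j; apply: smooth_has_partials cx; exact: field2_smooth. Qed.

Lemma acs_has_partials A : has_partialsmx (acs H A c) x.
Proof. by move=> i j; apply: smooth_has_partials cx; exact: field_end_smooth. Qed.

Lemma omega_has_partials A : has_partialsmx (omega H A c) x.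
Proof. exact (has_partialsmxM metric_has_partials (@acs_has_partials A)). Qed.

Lemma slice_nabla2_omega A a :
  slice (nabla2 D (omega H A) c x) a = metric H c x *m nabla_end D c x (acs H A) a.
Proof.
apply: slice_nabla2_mul metric_has_partials (@acs_has_partials A) _.
by apply/matrixP=> i j; rewrite !mxE; exact: hD.2.
Qed.

Lemma nabla_acs_sqr A a :
  nabla_end D c x (acs H A) a *m acs H A c x
  = - (acs H A c x *m nabla_end D c x (acs H A) a).
Proof.
apply/eqP; rewrite -addr_eq0 -nabla_endM; try exact: acs_has_partials.
rewrite (@eq_nabla_end _ _ _ _ _ _ _ (fun _ _ => - 1%:M)) //; last first.
  by move=> y cy; exact: acs_sqr.
by rewrite nabla_endN ?nabla_end1 ?oppr0 // => i j b; exact: derivable_cst.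
Qed.

Lemma nabla_acs_cyc A a :
  nabla_end D c x (acs H (cyc (cyc A))) a
  = - (nabla_end D c x (acs H (cyc A)) a *m acs H A c x
       + acs H (cyc A) c x *m nabla_end D c x (acs H A) a).
Proof.
have dA B := @acs_has_partials B.
rewrite -nabla_endM // -nabla_endN; last exact: has_partialsmxM.
by apply: eq_nabla_end => // y; exact: acs_cyc.
Qed.

Lemma slice_omega_acs A a :
  (acs H A c x)^T *m slice (nabla2 D (omega H A) c x) a
  = slice (nabla2 D (omega H A) c x) a *m acs H A c x.
Proof.
rewrite slice_nabla2_omega mulmxA acs_skew // -[RHS]mulmxA nabla_acs_sqr.
by rewrite mulmxN mulmxA mulNmx.
Qed.

(** Covariant differentiation of C = - B A, after moving B across the metric. *)
Lemma slice_omega_cyc A a :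
  (acs H (cyc A) c x)^T *m slice (nabla2 D (omega H A) c x) a
  = slice (nabla2 D (omega H (cyc (cyc A))) c x) a
    + slice (nabla2 D (omega H (cyc A)) c x) a *m acs H A c x.
Proof.
rewrite !slice_nabla2_omega mulmxA acs_skew // nabla_acs_cyc.
move: (nabla_end _ _ _ (acs H A) a) (nabla_end _ _ _ (acs H (cyc A)) a).
move=> N N'; rewrite mulmxN mulmxDr mulNmx !mulmxA.
by rewrite opprD addrAC addNr add0r.
Qed.

Lemma tri_omega_skew A U V W : tri (nabla2 D (omega H A) c x) U V W
  = - tri (nabla2 D (omega H A) c x) U W V.
Proof.
rewrite /tri; set S := \sum_a _.
have SK : S^T = - S.
  rewrite /S linear_sum -sumrN; apply: eq_bigr => a _.
  rewrite linearZ /= slice_nabla2_skew ?scalerN //; first exact: omega_has_partials.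
  by move=> y; exact: omega_skew.
have -> : V^T *m S *m W = - (W^T *m S *m V)^T.
  by rewrite !trmx_mul trmxK SK mulNmx mulmxN opprK mulmxA.
by move: (_ *m V) => X; rewrite !mxE.
Qed.

Lemma tri_omega_acs A U V W :
  tri (nabla2 D (omega H A) c x) U (acs H A c x *m V) W
  = tri (nabla2 D (omega H A) c x) U V (acs H A c x *m W).
Proof.
rewrite /tri trmx_mul !mulmxA; congr ((_ *m _) _ _); rewrite -!mulmxA.
congr (_ *m _); rewrite mulmx_sumr mulmx_suml; apply: eq_bigr => a _.
by rewrite -scalemxAr -scalemxAl slice_omega_acs.
Qed.

Lemma tri_omega_cyc A U V W :
  tri (nabla2 D (omega H A) c x) U (acs H (cyc A) c x *m V) W
  = tri (nabla2 D (omega H (cyc (cyc A))) c x) U V W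
    + tri (nabla2 D (omega H (cyc A)) c x) U V (acs H A c x *m W).
Proof.
have addE (X Y : 'M[R]_1) : X 0 0 + Y 0 0 = (X + Y) 0 0 by rewrite mxE.
rewrite /tri addE trmx_mul !mulmxA -mulmxDl; congr ((_ *m _) _ _).
rewrite -!mulmxA -mulmxDr; congr (_ *m _).
rewrite mulmx_sumr mulmx_suml -big_split; apply: eq_bigr => a _.
by rewrite -scalemxAr -scalemxAl /= -scalerDr slice_omega_cyc.
Qed.

Lemma nabla_omega_inversion A U V W :
  tri (nabla2 D (omega H A) c x) U V W
  = inversion (acs H A c x) (acs H (cyc A) c x) (ext_d (omega H A) c x)
      (ext_d (omega H (cyc A)) c x) (ext_d (omega H (cyc (cyc A))) c x) U V W.
Proof.
have Dsym k i j : D c x k i j = D c x k j i by exact: hD.1.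
rewrite !(ext_d_nabla2 Dsym); try exact: omega_skew.
apply: cyclic_sum_inversion.
- exact: acs_sqr.
- exact: acs_sqr.
- exact: acs_anticommute.
- exact: tri_omega_skew.
- exact: tri_omega_skew.
- exact: tri_omega_skew.
- exact: tri_omega_acs.
- exact: tri_omega_cyc.
Qed.

Lemma OmegaE : Omega H = fun c y i j k l =>
  wedge22 (omega H hI c y) (omega H hI c y) i j k l
  + (wedge22 (omega H hJ c y) (omega H hJ c y) i j k l
     + wedge22 (omega H hK c y) (omega H hK c y) i j k l).
Proof.
apply: funext => d; apply: funext => y; apply: funext => i; apply: funext => j.
apply: funext => k; apply: funext => l.
by rewrite /Omega !big_cons big_nil addr0.
Qed.

Lemma nabla4_Omega a i j k l : nabla4 D (Omega H) c x a i j k l =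
  2 * \sum_(A <- [:: hI; hJ; hK])
    wedge22 (omega H A c x) (slice (nabla2 D (omega H A) c x) a) i j k l.
Proof.
have dw A p q r s :
    has_partials (fun y => wedge22 (omega H A c y) (omega H A c y) p q r s) x.
  exact: has_partials_wedge22 (@omega_has_partials A).
rewrite OmegaE nabla4D //; last by move=> *; exact: has_partialsD.
rewrite nabla4D // !nabla4_wedge22; try exact: omega_has_partials.
by rewrite !big_cons big_nil addr0 !mulrDr.
Qed.

End Hyperhermitian.

(** * The determining functions *)

(** The basis vectors are the vectors of the frame in which J and d are given. *)
Definition nabla_omega_of (R : realType) (m : nat) (A : hyper)
    (J : hyper -> 'M[R]_m) (d : hyper -> cov3 R m) : cov3 R m :=
  fun i j k => inversion (J A) (J (cyc A)) (d A) (d (cyc A)) (d (cyc (cyc A)))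
    (delta_mx i 0) (delta_mx j 0) (delta_mx k 0).

Definition nabla_Omega_of (R : realType) (m : nat) (g : 'M[R]_m)
    (J : hyper -> 'M[R]_m) (d : hyper -> cov3 R m) : cov5 R m :=
  fun a i j k l => 2 * \sum_(A <- [:: hI; hJ; hK])
    wedge22 (g *m J A) (slice (nabla_omega_of A J d) a) i j k l.

Theorem theorem4p1 (R : realType) (n : nat) (hn : (0 < n)%N) :
  (exists (F : hyper -> 'M[R]_(4 * n) -> (hyper -> 'M[R]_(4 * n)) ->
               (hyper -> cov3 R (4 * n)) -> cov3 R (4 * n))
          (FOmega : 'M[R]_(4 * n) -> (hyper -> 'M[R]_(4 * n)) ->
               (hyper -> cov3 R (4 * n)) -> cov5 R (4 * n)),
     forall (M : manifold R (4 * n)) (H : almost_hyperhermitian M)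
            (D : connection M) (hD : levi_civita (metric H) D)
            (p : M) (c : chart M) (hp : chart_dom c p)
            (P : 'M[R]_(4 * n)) (hP : P \in unitmx),
       let x := chart_map c p in
       (forall A : hyper,
          frame3 P (nabla2 D (omega H A) c x) =
          F A (metric_at H c x P) (acs_at H c x P) (d_omega_at H c x P)) /\
       frame5 P (nabla4 D (Omega H) c x) =
       FOmega (metric_at H c x P) (acs_at H c x P) (d_omega_at H c x P)) /\
  (forall (M : manifold R (4 * n)) (H : almost_hyperhermitian M)
          (D : connection M) (hD : levi_civita (metric H) D)
          (p : M) (c : chart M) (hp : chart_dom c p) (a i j k l : 'I_(4 * n)),
     let x := chart_map c p in
     nabla4 D (Omega H) c x a i j k l =
     2 * \sum_(A <- [:: hI; hJ; hK])
       wedge22 (omega H A c x)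
         (\matrix_(s, t) nabla2 D (omega H A) c x a s t) i j k l).
Proof.
have cp (M : manifold R (4 * n)) (p : M) (c : chart M) :
  chart_dom c p -> img c (chart_map c p) by move=> hp; exists p.
split; last first.
  by move=> M H D hD p c hp a i j k l x; rewrite nabla4_Omega //; exact: cp.
exists (fun A _ => nabla_omega_of A), (@nabla_Omega_of R (4 * n)).
move=> M H D hD p c hp P hP x; have cx : img c x by exact: cp.
have FE A : frame3 P (nabla2 D (omega H A) c x)
    = nabla_omega_of A (acs_at H c x P) (d_omega_at H c x P).
  apply: eq_cov3 => i j k; rewrite /nabla_omega_of inversion_frame //.
  by rewrite frame3_tri nabla_omega_inversion // -!colE.
split=> //; apply: funext => a; apply: funext => i; apply: funext => j.
apply: funext => k; apply: funext => l.
have frame5_sum (T : hyper -> cov5 R (4 * n)) :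
    frame5 P (fun a i j k l => 2 * \sum_(A <- [:: hI; hJ; hK]) T A a i j k l)
      a i j k l
    = 2 * \sum_(A <- [:: hI; hJ; hK]) frame5 P (T A) a i j k l.
  rewrite /frame5.
  rewrite [in RHS]exchange_big mulr_sumr; apply: eq_bigr => a' _.
  rewrite [in RHS]exchange_big mulr_sumr; apply: eq_bigr => b' _.
  rewrite [in RHS]exchange_big mulr_sumr; apply: eq_bigr => c' _.
  rewrite [in RHS]exchange_big mulr_sumr; apply: eq_bigr => d' _.
  rewrite [in RHS]exchange_big mulr_sumr; apply: eq_bigr => e' _.
  by rewrite mulrCA [in LHS]mulr_sumr.
have -> : nabla4 D (Omega H) c x = fun a i j k l =>
    2 * \sum_(A <- [:: hI; hJ; hK])
      wedge22 (omega H A c x) (slice (nabla2 D (omega H A) c x) a) i j k l.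
  apply: funext => a'; apply: funext => i'; apply: funext => j'.
  by apply: funext => k'; apply: funext => l'; exact: nabla4_Omega.
rewrite frame5_sum /nabla_Omega_of; congr (_ * _); apply: eq_bigr => A _.
rewrite frame5_wedge22 FE; congr (wedge22 _ _ _ _ _ _).
rewrite /frame2 /omega /metric_at /acs_at /frame_end /frame2 !mulmxA.
by rewrite -[P^T *m _ *m P *m invmx P]mulmxA mulmxV // mulmx1.
Qed.
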